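(* Let $0 < \nu < 1$, $\lambda \in \mathbb{R}$ with $|\lambda| < 1$, and $m \in \mathbb{N}_1$. Let $\hat{e}_{\nu,\nu}(\lambda, t^{\overline{\nu}})$, $t \in \mathbb{N}_0$, denote the unique solution $w : \mathbb{N}_0 \to \mathbb{R}$ of the initial value problem $$\big(\nabla^{\nu}_{\rho(0)} w\big)(t) = \lambda w(t) \quad (t \in \mathbb{N}_1), \qquad \big(\nabla^{-(1-\nu)}_{\rho(0)} w\big)(0) = w(0) = 1.$$ Let $\mathcal{L} = [\mathcal{L}_{ij}]$ be the $m \times m$ lower triangular matrix with $$\mathcal{L}_{ij} = \begin{cases} 1 - \lambda, & i = j, \\ 0, & i < j, \\ H_{-\nu-1}(i, \rho(j)), & i > j, \end{cases}$$ and let $\mathcal{B} \in \mathbb{R}^m$ be the column vector with entries $\mathcal{B}_i = H_{-\nu-1}(i, \rho(0))$, $1 \le i \le m$. Then $\mathcal{L}$ is non-singular and $$\big[\hat{e}_{\nu,\nu}(\lambda, 1^{\overline{\nu}}), \hat{e}_{\nu,\nu}(\lambda, 2^{\overline{\nu}}), \ldots, \hat{e}_{\nu,\nu}(\lambda, m^{\overline{\nu}})\big]^T = -\mathcal{L}^{-1}\mathcal{B}.$$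
   Context: For $a \in \mathbb{R}$, $\mathbb{N}_a = \{a, a+1, a+2, \ldots\}$. The backward jump operator is $\rho(t) = t - 1$; in particular $\rho(0) = -1$. Nabla fractional Taylor monomials: for $\mu \in \mathbb{R} \setminus \{\ldots, -2, -1\}$, $$H_\mu(t,a) = \frac{\Gamma(t-a+\mu)}{\Gamma(t-a)\,\Gamma(\mu+1)}$$ whenever the right-hand side is sensible, where $\Gamma$ is the Euler gamma function. In particular $H_\mu(t,\rho(t)) = 1$ for such $\mu$. The nabla difference is $(\nabla u)(t) = u(t) - u(t-1)$. For $u : \mathbb{N}_{a+1} \to \mathbb{R}$ and $\alpha > 0$, the $\alpha$-th order nabla sum based at $a$ is $$(\nabla_a^{-\alpha} u)(t) = \sum_{s=a+1}^{t} H_{\alpha-1}(t,\rho(s))\,u(s), \quad t \in \mathbb{N}_a,$$ with the convention $(\nabla_a^{-\alpha}u)(a) = 0$. For $u : \mathbb{N}_{a+1} \to \mathbb{R}$ and $0 < \nu < 1$, the Riemann--Liouville nabla fractional difference based at $a$ is $$(\nabla_a^{\nu} u)(t) = \Big(\nabla\big(\nabla_a^{-(1-\nu)}u\big)\Big)(t), \quad t \in \mathbb{N}_{a+1}.$$ In $\hat{e}_{\nu,\nu}(\lambda, t^{\overline{\nu}})$ the symbol $t^{\overline{\nu}}$ is only part of the notation for the function of $t$. *)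

(* Defs.v *)
From HB Require Import structures.
From mathcomp Require Import all_boot all_order all_algebra.
From mathcomp Require Import all_classical all_reals all_analysis.
Set Implicit Arguments.
Unset Strict Implicit.
Unset Printing Implicit Defensive.
Import Order.TTheory GRing.Theory Num.Theory.
Import numFieldNormedType.Exports.
Local Open Scope classical_set_scope.
Local Open Scope ring_scope.

(* Euler's integral of the second kind; meaningful for 0 < x. *)
Definition Gamma_integral (R : realType) (x : R) : R :=
  \int[lebesgue_measure]_(s in `]0, +oo[) (s `^ (x - 1) * expR (- s)).

(* Extension to the non-positive, non-integer reals through
   Gamma(x) = Gamma(x + n) / (x (x + 1) ... (x + n - 1)), where
   n = truncn (1 - x) is the least natural number such that 0 < x + n
   (so n = 0 and Gamma x = Gamma_integral x when 0 < x).  At the poles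
   0, -1, -2, ... the value is the junk value 0. *)
Definition Gamma (R : realType) (x : R) : R :=
  let n := Num.truncn (1 - x) in
  Gamma_integral (x + n%:R) / \prod_(k < n) (x + k%:R).

(* N_a = {a, a + 1, a + 2, ...} *)
Definition nats_from (R : realType) (a : R) : set R :=
  [set t | exists n : nat, t = a + n%:R].

Definition rho (R : realType) (t : R) : R := t - 1.

Definition H (R : realType) (mu t a : R) : R :=
  Gamma (t - a + mu) / (Gamma (t - a) * Gamma (mu + 1)).

Definition nabla (R : realType) (u : R -> R) (t : R) : R := u t - u (t - 1).

(* A function on N_b is encoded as a function R -> R of which only the values
   on N_b are used.  The index set below is {a + 1, ..., t}; it is empty when
   t = a, which gives the convention that the sum vanishes at a. *)
Definition nabla_sum (R : realType) (a alpha : R) (u : R -> R) (t : R) : R :=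
  \sum_(s \in nats_from (a + 1) `&` [set s | s <= t])
    H (alpha - 1) t (rho s) * u s.

Definition nabla_RL (R : realType) (a nu : R) (u : R -> R) (t : R) : R :=
  nabla (nabla_sum a (1 - nu) u) t.

(* The initial value problem whose unique solution on N_0 is the function
   \hat e_{nu,nu}(lambda, t^{\overline nu}). *)
Definition ml_ivp (R : realType) (nu lambda : R) (w : R -> R) : Prop :=
  [/\ forall t, nats_from 1 t -> nabla_RL (rho 0) nu w t = lambda * w t,
      nabla_sum (rho 0) (1 - nu) w 0 = w 0
    & w 0 = 1].

(* Ordinals i : 'I_m are zero-based: i stands for the index i + 1. *)
Definition Lmx (R : realType) (nu lambda : R) (m : nat) : 'M[R]_m :=
  \matrix_(i < m, j < m)
    if i == j then 1 - lambda
    else if (i < j)%N then 0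
    else H (- nu - 1) i.+1%:R (rho j.+1%:R).

Definition Bcol (R : realType) (nu : R) (m : nat) : 'cV[R]_m :=
  \col_(i < m) H (- nu - 1) i.+1%:R (rho 0).

(* Main.v *)
Require Import Defs.
From HB Require Import structures.
From mathcomp Require Import all_boot all_order all_algebra.
From mathcomp Require Import all_classical all_reals all_analysis.
From mathcomp Require Import measurable_realfun ring.
Import Order.TTheory GRing.Theory Num.Theory.
Import numFieldNormedType.Exports.
Local Open Scope classical_set_scope.
Local Open Scope ring_scope.

(** With [a = rho 0] the order [1 - nu] nabla sum is a discrete convolution
    whose kernel [H_{-nu}] equals 1 on the diagonal, and
    [Gamma (x + 1) = x * Gamma x] gives the Pascal rule
    [nabla H_{-nu} = H_{-nu-1}].  Hence the initial value problem says
    [w 0 = 1] and, for all [n >= 1],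
    [(1 - lambda) w n + \sum_(k < n) H_{-nu-1}(n, rho k) w k = 0]:
    a recursion with a unique solution since [lambda <> 1], whose first [m]
    equations are the lower triangular system [L w = - B]. *)

(** * Euler's integrand and integration by parts *)

Definition Gamma_integrand {R : realType} (x s : R) : R :=
  s `^ (x - 1) * expR (- s).

Lemma Gamma_integrand_ge0 {R : realType} (x s : R) : 0 <= Gamma_integrand x s.
Proof. by rewrite mulr_ge0 ?powR_ge0 ?expR_ge0. Qed.

Lemma measurable_Gamma_integrand {R : realType} (x : R) (D : set R) :
  measurable_fun D (Gamma_integrand x).
Proof.
apply: measurable_funTS; apply: measurable_funM; first exact: measurable_powR.
by apply: measurableT_comp => //; exact: measurable_oppr.
Qed.

Lemma is_derive_expRN {R : realType} (s : R) :
  is_derive s 1 (fun s : R => expR (- s)) (- expR (- s)).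
Proof.
have h : is_derive (- s) 1 (@expR R) (expR (- s)) by exact: is_derive_expR.
by apply: is_derive_eq; rewrite mulrN1.
Qed.

(* Stated in the extended reals and on a compact interval, so that no
   integrability at 0 or at infinity is needed. *)
Lemma Gamma_integrand_parts {R : realType} (x a b : R) : 0 <= x -> 0 < a -> a < b ->
  (\int[lebesgue_measure]_(s in `[a, b]) (Gamma_integrand (x + 1) s)%:E =
  (a `^ x * expR (- a) - b `^ x * expR (- b))%:E +
   \int[lebesgue_measure]_(s in `[a, b]) (x * Gamma_integrand x s)%:E)%E.
Proof.
move=> x0 a0 ab.
have pos s : s \in `[a, b] -> 0 < s.
  by rewrite in_itv/= => /andP[/(lt_le_trans a0)].
have dpow s : 0 < s -> {for s, continuous (fun s : R => s `^ x)}.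
  move=> s0; apply/differentiable_continuous/derivable1_diffP.
  by have [] := is_derive1_powR x s0.
have dpow1 s : 0 < s -> {for s, continuous (fun s : R => x * s `^ (x - 1))}.
  move=> s0; apply: (@continuousM _ _ (cst x)); first exact: cst_continuous.
  apply/differentiable_continuous/derivable1_diffP.
  by have [] := is_derive1_powR (x - 1) s0.
have dexp s : {for s, continuous (fun s : R => expR (- s))}.
  apply/differentiable_continuous/derivable1_diffP.
  by have [] := is_derive_expRN s.
have sub (f : R -> R) : (forall s, 0 < s -> {for s, continuous f}) ->
    {within `[a, b], continuous f}.
  move=> cf; apply: continuous_in_subspaceT => s /set_mem sab.
  exact/cf/pos.
have oo s : s \in `]a, b[ -> 0 < s.
  by move=> h; apply: pos; exact: subset_itv_oo_cc.
rewrite /Gamma_integrand addrK.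
have -> := @integration_by_parts R (fun s => s `^ x) (fun s => - expR (- s))
  (fun s => x * s `^ (x - 1)) (fun s => expR (- s)) a b ab.
- congr (_ + _)%E; first by rewrite !mulrN opprK addrC.
  under eq_integral do rewrite mulrN EFinN -mulrA.
  rewrite integral_ge0N ?oppeK// => s _.
  by rewrite lee_fin mulr_ge0// Gamma_integrand_ge0.
- exact: sub.
- split.
  + by move=> s /oo s0; have [] := is_derive1_powR x s0.
  + exact/cvg_at_right_filter/dpow.
  + exact/cvg_at_left_filter/dpow/(lt_trans a0).
- move=> s /oo s0; rewrite derive1E.
  by have [] := is_derive1_powR x s0.
- by apply: sub => s _; exact: dexp.
- split.
  + by move=> s _; apply: derivableN; have [] := is_derive_expRN s.
  + by apply: cvgN; exact/cvg_at_right_filter/dexp.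
  + by apply: cvgN; exact/cvg_at_left_filter/dexp.
- move=> s _; have [ds es] := is_derive_expRN s.
  by rewrite derive1E deriveN// es opprK.
Qed.

(** * Functional equation of Euler's integral, by exhaustion *)

(** The exponential dominates the term of degree [k.+2] of its series, while [x < k.+1]; the spare
    power of [s] gives the decay. *)
Lemma powR_expRN_le {R : realType} (x s : R) : 1 <= s ->
  s `^ x * expR (- s) <= ((Num.truncn x).+2)`!%:R / s.
Proof.
move=> s1; set k := Num.truncn x.
have s0 : 0 < s by exact: lt_le_trans s1.
have h1 : s `^ x <= s ^+ k.+1.
  rewrite -powR_mulrn; last exact: ltW.
  apply: ler_powR => //.
  exact/ltW/truncnS_gt.
have h2 : s ^+ k.+2 / (k.+2)`!%:R <= expR s.
  by apply: le_trans (expR_ge1Dxn k.+1 (ltW s0)); rewrite lerDr.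
rewrite expRN ler_pdivrMr ?expR_gt0// mulrAC ler_pdivlMr//.
apply: (@le_trans _ _ (s ^+ k.+2)); first by rewrite exprSr ler_pM2r.
by rewrite mulrC -ler_pdivrMr// ltr0n fact_gt0.
Qed.

(** The upper end is [n.+2] so that even for [n = 0] the endpoints are distinct, as
    [Gamma_integrand_parts] requires. *)
Definition exhausting_itv (R : realType) (n : nat) : set R :=
  `[n.+1%:R^-1, n.+2%:R]%classic.

Lemma bigcup_exhausting_itv (R : realType) :
  \bigcup_n exhausting_itv R n = `]0, +oo[%classic.
Proof.
apply/seteqP; split=> [s [n _]|s].
  rewrite /exhausting_itv/= !in_itv/= andbT => /andP[+ _].
  by apply: lt_le_trans; rewrite invr_gt0.
rewrite /= in_itv/= andbT => s0.
(* For this [n], [n.+1] exceeds both [s] and its inverse. *)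
exists (Num.truncn (Num.max s s^-1)) => //; rewrite /exhausting_itv/= in_itv/=.
have := truncnS_gt (Num.max s s^-1).
rewrite gt_max => /andP[h1 h2]; apply/andP; split.
  by rewrite -[leRHS]invrK lef_pV2 ?posrE ?invr_gt0// ltW.
by apply/ltW/(lt_trans h1); rewrite ltr_nat.
Qed.

(** Monotone convergence along increasing sets; the limit may be infinite. *)
Lemma cvg_exhausting_integral {R : realType} (f : R -> R) :
  measurable_fun setT f -> (forall s, 0 <= f s) ->
  (\int[lebesgue_measure]_(s in exhausting_itv R n) (f s)%:E @[n --> \oo] -->
   \int[lebesgue_measure]_(s in `]0%R, +oo[) (f s)%:E)%E.
Proof.
move=> mf f0; rewrite -bigcup_exhausting_itv.
apply: ge0_nondecreasing_set_cvg_integral.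
- move=> m n mn; apply/subsetPset; apply: subset_itv; rewrite bnd_simp.
    by rewrite lef_pV2 ?posrE// ler_nat.
  by rewrite ler_nat.
- by move=> n; exact: measurable_itv.
- by move=> n; apply/measurable_funTS/measurable_EFinP.
- by move=> n s _; rewrite lee_fin.
Qed.

(** At 0 the power tends to 0 because [0 < x], and the exponential is at most 1; at infinity
    [powR_expRN_le] gives the decay. *)
Lemma cvg_Gamma_boundary {R : realType} (x : R) : 0 < x ->
  n.+1%:R^-1 `^ x * expR (- n.+1%:R^-1) - n.+2%:R `^ x * expR (- n.+2%:R)
    @[n --> \oo] --> (0 : R).
Proof.
move=> x0; rewrite -[X in _ --> X](subr0 0); apply: cvgB.
  apply: (@squeeze_cvgr _ _ _ _ (cst 0) (fun n => (n.+1%:R^-1 : R) `^ x)).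
  - near=> n; rewrite mulr_ge0 ?powR_ge0 ?expR_ge0//= ler_piMr ?powR_ge0//.
  - exact: cvg_cst.
  - have /cvg_at_rightP := powR_cvg0 x0; apply; split=> [n|].
      by rewrite invr_gt0.
    exact: cvg_harmonic.
apply: (@squeeze_cvgr _ _ _ _ (cst 0)
  (fun n => ((Num.truncn x).+2)`!%:R * @harmonic R n)).
- near=> n; rewrite mulr_ge0 ?powR_ge0 ?expR_ge0//=.
  apply: (le_trans (powR_expRN_le x _ _)); first by rewrite ler1n.
  by rewrite ler_wpM2l// lef_pV2 ?posrE// ler_nat.
- exact: cvg_cst.
- rewrite -(mulr0 ((Num.truncn x).+2)`!%:R).
  by apply: cvgM; [exact: cvg_cst|exact: cvg_harmonic].
Unshelve. all: by end_near. Qed.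

(** Limit of the integration by parts, whose boundary terms vanish; uniqueness of limits in the
    extended reals covers infinite integrals as well. *)
Lemma integral_Gamma_integrandS {R : realType} (x : R) : 0 < x ->
  (\int[lebesgue_measure]_(s in `]0%R, +oo[) (Gamma_integrand (x + 1) s)%:E =
   x%:E * \int[lebesgue_measure]_(s in `]0%R, +oo[) (Gamma_integrand x s)%:E)%E.
Proof.
move=> x0; rewrite -ge0_integralZl_EFin ?ltW//; last 2 first.
- move=> s _; rewrite lee_fin; exact: Gamma_integrand_ge0.
- by apply/measurable_EFinP; exact: measurable_Gamma_integrand.
have h1 := cvg_exhausting_integral _ (measurable_Gamma_integrand (x + 1) _)
  (Gamma_integrand_ge0 (x + 1)).
have h2 : (\int[lebesgue_measure]_(s in exhausting_itv R n)
    (x * Gamma_integrand x s)%:E @[n --> \oo] -->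
   \int[lebesgue_measure]_(s in `]0%R, +oo[) (x * Gamma_integrand x s)%:E)%E.
  apply: cvg_exhausting_integral => [|s].
    by apply: measurable_funM => //; exact: measurable_Gamma_integrand.
  by rewrite mulr_ge0 ?Gamma_integrand_ge0// ltW.
have h3 : ((n.+1%:R^-1 `^ x * expR (- n.+1%:R^-1) -
    n.+2%:R `^ x * expR (- n.+2%:R))%:E @[n --> \oo] --> (0 : \bar R))%E.
  by apply: cvg_EFin; [exact: nearW|exact: cvg_Gamma_boundary].
have := cvgeD _ h3 h2; rewrite add0e => h4.
have E n : (\int[lebesgue_measure]_(s in exhausting_itv R n)
      (Gamma_integrand (x + 1) s)%:E =
    (n.+1%:R^-1 `^ x * expR (- n.+1%:R^-1) -
      n.+2%:R `^ x * expR (- n.+2%:R))%:E +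
    \int[lebesgue_measure]_(s in exhausting_itv R n)
      (x * Gamma_integrand x s)%:E)%E.
  apply: Gamma_integrand_parts; rewrite ?invr_gt0// ?ltW//.
  by rewrite (@le_lt_trans _ _ 1) ?ltr1n// invf_le1// ler1n.
apply: (cvg_unique _ h1) => //; rewrite (funext E).
by apply: h4; exact: fin_num_adde_defr.
Qed.

(** * Finiteness and positivity of Euler's integral *)

Lemma integral_Gamma_integrand1 {R : realType} :
  (\int[lebesgue_measure]_(s in `]0%R, +oo[) (Gamma_integrand (1 : R) s)%:E
   = 1)%E.
Proof.
have E (s : R) : Gamma_integrand 1 s = expR (- s).
  by rewrite /Gamma_integrand subrr powRr0 mul1r.
(* Adding the null point 0 matches the support of the exponential density of rate 1, whose mass is
   1. *)
rewrite integral_itv_obnd_cbnd; last first.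
  by apply/measurable_EFinP; exact: measurable_Gamma_integrand.
rewrite -(@integral_exponential_pdf R 1)//.
rewrite [LHS]integral_mkcond; apply: eq_integral => s _.
rewrite /exponential_pdf !patchE; case: ifPn => // _.
by rewrite E mul1r mulN1r.
Qed.

(* By the functional equation it is enough to bound the integral at [x + 1],
   where [s `^ x <= 1 + s] has no singularity at 0. *)
Lemma integral_Gamma_integrand_fin_num {R : realType} (x : R) : 0 < x <= 1 ->
  (\int[lebesgue_measure]_(s in `]0%R, +oo[) (Gamma_integrand x s)%:E)%E
    \is a fin_num.
Proof.
move=> /andP[x0 x1].
have I0 : (0 <= \int[lebesgue_measure]_(s in `]0%R, +oo[)
    (Gamma_integrand x s)%:E)%E.
  by apply: integral_ge0 => s _; rewrite lee_fin Gamma_integrand_ge0.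
rewrite ge0_fin_numE//.
(* The bound is the sum of the integrals at 1 and at 2, that is, the integral of
   [(1 + s) * expR (- s)]. *)
have : (\int[lebesgue_measure]_(s in `]0%R, +oo[)
    (Gamma_integrand (x + 1) s)%:E <= 1 + 1)%E.
  have I2 : (\int[lebesgue_measure]_(s in `]0%R, +oo[)
      (Gamma_integrand (1 + 1 : R) s)%:E = 1)%E.
    by rewrite integral_Gamma_integrandS// integral_Gamma_integrand1 mule1.
  rewrite -{2}I2 -integral_Gamma_integrand1 -ge0_integralD//; last 4 first.
  - by move=> s _; rewrite lee_fin Gamma_integrand_ge0.
  - by apply/measurable_EFinP; exact: measurable_Gamma_integrand.
  - by move=> s _; rewrite lee_fin Gamma_integrand_ge0.
  - by apply/measurable_EFinP; exact: measurable_Gamma_integrand.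
  apply: ge0_le_integral => //.
  - by move=> s _; rewrite lee_fin Gamma_integrand_ge0.
  - by apply/measurable_EFinP; exact: measurable_Gamma_integrand.
  - by apply/emeasurable_funD; apply/measurable_EFinP;
      exact: measurable_Gamma_integrand.
  move=> s; rewrite /= in_itv/= andbT => s0.
  rewrite -EFinD lee_fin /Gamma_integrand !addrK subrr powRr0 powRr1 ?(ltW s0)//.
  rewrite -mulrDl ler_pM2r ?expR_gt0//; have [s1|/ltW s1] := leP s 1.
    apply: (@le_trans _ _ 1); last by rewrite lerDl ltW.
    by rewrite -(powRr0 s); apply: ger_powR; [rewrite s0|exact: ltW].
  by apply: (le_trans (ler1_powR s1 x1)); rewrite lerDr.
(* An infinite integral at [x] would stay infinite after multiplication by [x]. *)
rewrite integral_Gamma_integrandS//; move: I0.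
by case: (\int[_]_(_ in _) _)%E => [r _ _|_|//]; rewrite ?ltry// gt0_muley ?lte_fin.
Qed.

(** On []0, 1]] the power is at least 1 and the exponential at least [expR (- 1)]. Finiteness
    matters too: [fine] would send an infinite integral to 0. *)
Lemma Gamma_integral_gt0 {R : realType} (x : R) : 0 < x <= 1 ->
  0 < Gamma_integral x.
Proof.
move=> x01; have /andP[x0 x1] := x01.
have := integral_Gamma_integrand_fin_num _ x01.
have : ((expR (-1))%:E <= \int[lebesgue_measure]_(s in `]0%R, +oo[)
    (Gamma_integrand x s)%:E)%E.
  apply: (@le_trans _ _ (\int[lebesgue_measure]_(s in `]0%R, 1%R])
    (Gamma_integrand x s)%:E)%E).
    have -> : (expR (- 1 : R))%:E = (\int[@lebesgue_measure R]_(s in `]0%R, 1%R])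
        (cst (expR (- 1))%:E s))%E.
      rewrite integral_cst//= lebesgue_measure_itv/= lte_fin ltr01.
      by rewrite sube0 mule1.
    apply: ge0_le_integral => //.
    - by move=> s _; rewrite lee_fin expR_ge0.
    - by apply/measurable_EFinP; exact: measurable_Gamma_integrand.
    move=> s; rewrite /= in_itv/= => /andP[s0 s1].
    rewrite lee_fin /Gamma_integrand -[leLHS]mul1r ler_pM ?expR_ge0//.
      rewrite -[leLHS](powRr0 s); apply: ger_powR; first by rewrite s0.
      by rewrite subr_le0.
    by rewrite ler_expR lerN2.
  apply: ge0_subset_integral => //.
  - by apply/measurable_EFinP; exact: measurable_Gamma_integrand.
  - by move=> s _; rewrite lee_fin Gamma_integrand_ge0.
  - by apply: subset_itvl; rewrite bnd_simp.
move=> h fin; rewrite /Gamma_integral /Rintegral -lte_fin fineK//.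
by apply: lt_le_trans h; rewrite lte_fin expR_gt0.
Qed.

(** * The Gamma function: functional equation and values *)

Lemma Gamma_integralS {R : realType} (x : R) : 0 < x ->
  Gamma_integral (x + 1) = x * Gamma_integral x.
Proof.
move=> x0; rewrite /Gamma_integral /Rintegral.
have := integral_Gamma_integrandS _ x0; rewrite /Gamma_integrand => ->.
(* [fine] sends both infinities to 0, so those cases read [0 = x * 0]. *)
case: (\int[_]_(_ in _) _)%E => [r|/=|/=] //.
  by rewrite gt0_muley ?lte_fin// mulr0.
by rewrite gt0_muleNy ?lte_fin// mulr0.
Qed.

Lemma GammaE {R : realType} (x : R) : 0 < x -> Gamma x = Gamma_integral x.
Proof.
move=> x0; rewrite /Gamma (_ : Num.truncn _ = 0%N).
  by rewrite addr0 big_ord0 divr1.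
by apply/eqP; rewrite -leqn0 leqNgt truncn_gt0 -ltNge ltrBlDr ltrDl.
Qed.

Lemma GammaS {R : realType} (x : R) : 0 < x -> Gamma (x + 1) = x * Gamma x.
Proof. by move=> x0; rewrite !GammaE ?Gamma_integralS// addr_gt0. Qed.

Lemma Gamma1 {R : realType} : Gamma (1 : R) = 1.
Proof.
rewrite GammaE// /Gamma_integral /Rintegral.
by have := @integral_Gamma_integrand1 R; rewrite /Gamma_integrand => ->.
Qed.

Lemma Gamma_nat {R : realType} (n : nat) : Gamma (n.+1%:R : R) = n`!%:R.
Proof.
elim: n => [|n ih]; first exact: Gamma1.
by rewrite -natr1 GammaS// ih factS natrM.
Qed.

(** Between -1 and 0 the extension of Gamma takes exactly one shift; this value normalises
    [H (- nu - 1)]. *)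
Lemma Gamma_opp {R : realType} (nu : R) : 0 < nu -> nu < 1 ->
  Gamma (- nu) = Gamma (1 - nu) / - nu.
Proof.
move=> nu0 nu1; rewrite [in RHS]GammaE ?subr_gt0// /Gamma.
rewrite (@truncn_def _ _ 1%N); first by rewrite big_ord1 addr0 addrC.
by rewrite opprK lerDl ltW//= (_ : 2%:R = 1 + 1)// ltrD2l.
Qed.

(** * The Taylor monomials at integers *)

Lemma H_natE {R : realType} (mu : R) (n k : nat) : (k <= n)%N ->
  H mu n%:R (rho k%:R) =
  Gamma ((n - k).+1%:R + mu) / ((n - k)`!%:R * Gamma (mu + 1)).
Proof.
move=> kn; rewrite /H /rho.
have -> : n%:R - (k%:R - 1) = (n - k).+1%:R :> R.
  by rewrite -natr1 natrB// opprB addrA addrAC.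
by rewrite Gamma_nat.
Qed.

Lemma Gamma_gt0_01 {R : realType} (nu : R) : 0 < nu -> nu < 1 ->
  0 < Gamma (1 - nu).
Proof.
move=> nu0 nu1; rewrite GammaE ?subr_gt0// Gamma_integral_gt0//.
by rewrite subr_gt0 nu1 gerBl ltW.
Qed.

Lemma H_diag {R : realType} (nu : R) (n : nat) : 0 < nu -> nu < 1 ->
  H (- nu) n%:R (rho n%:R) = 1.
Proof.
move=> nu0 nu1; rewrite H_natE// subnn fact0 mul1r [- nu + 1]addrC divff//.
by rewrite gt_eqF// Gamma_gt0_01.
Qed.

(** With [d = n - k], both sides equal [- nu * Gamma (d + 1 - nu) / ((d + 1)! * Gamma (1 - nu))]. *)
Lemma nabla_H {R : realType} (nu : R) (n k : nat) : 0 < nu -> nu < 1 ->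
  (k <= n)%N ->
  H (- nu) n.+1%:R (rho k%:R) - H (- nu) n%:R (rho k%:R) =
  H (- nu - 1) n.+1%:R (rho k%:R).
Proof.
move=> nu0 nu1 kn; have G0 := Gamma_gt0_01 _ nu0 nu1.
rewrite !H_natE ?leqW// subSn// subrK Gamma_opp// [- nu + 1]addrC.
set d := (n - k)%N.
have d0 : 0 < d.+1%:R - nu by rewrite subr_gt0 (lt_le_trans nu1)// ler1n.
rewrite -[d.+2%:R]natr1 [_ + 1 - nu]addrAC GammaS// addrACA subrr addr0 factS.
rewrite natrM.
have f0 : d`!%:R != 0 :> R by rewrite pnatr_eq0 -lt0n fact_gt0.
have d1 : d.+1%:R != 0 :> R by rewrite pnatr_eq0.
by field; rewrite nat1r f0 (gt_eqF G0) (gt_eqF nu0).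
Qed.

(** * The initial value problem as a recursion *)

(** Since [rho 0 + 1 = 0], the summation starts at 0; the injective cast from [nat] reindexes it. *)
Lemma nabla_sum_nat {R : realType} (alpha : R) (u : R -> R) (n : nat) :
  nabla_sum (rho 0) alpha u n%:R =
  \sum_(k < n.+1) H (alpha - 1) n%:R (rho k%:R) * u k%:R.
Proof.
pose F (s : R) := H (alpha - 1) n%:R (rho s) * u s.
apply: etrans; last exact/esym/(fsbig_ord _ _ (fun k => F k%:R)).
rewrite -(fsbig_image _ (fun k : nat => k%:R : R) F); last first.
  by move=> i j _ _ /eqP; rewrite eqr_nat => /eqP.
apply: eq_fsbigl; apply/seteqP; split=> s /=.
  rewrite /rho sub0r addNr => -[[k ->]]; rewrite add0r ler_nat => kn.
  by exists k.
move=> [k kn <-]; split; last by rewrite ler_nat.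
by exists k; rewrite /rho sub0r addNr add0r.
Qed.

(** The newest term of the sum at [n.+1] has coefficient 1 by [H_diag]; the older ones pair with the
    sum at [n] through [nabla_H]. *)
Lemma nabla_RL_nat {R : realType} (nu : R) (u : R -> R) (n : nat) :
  0 < nu -> nu < 1 ->
  nabla_RL (rho 0) nu u n.+1%:R =
  u n.+1%:R + \sum_(k < n.+1) H (- nu - 1) n.+1%:R (rho k%:R) * u k%:R.
Proof.
move=> nu0 nu1; rewrite /nabla_RL /nabla -{2}natr1 addrK !nabla_sum_nat.
have -> : 1 - nu - 1 = - nu by rewrite addrAC subrr add0r.
rewrite big_ord_recr/= H_diag// mul1r addrAC -sumrB addrC; congr (_ + _).
by apply: eq_bigr => k _; rewrite -mulrBl nabla_H// -ltnS.
Qed.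

Lemma ml_ivpP {R : realType} (nu lambda : R) (w : R -> R) :
  0 < nu -> nu < 1 ->
  ml_ivp nu lambda w <->
  w 0 = 1 /\ forall n : nat, (1 - lambda) * w n.+1%:R +
    \sum_(k < n.+1) H (- nu - 1) n.+1%:R (rho k%:R) * w k%:R = 0.
Proof.
move=> nu0 nu1; split=> [[wE _ w0]|[w0 wE]]; split=> //.
- move=> n; have /wE : nats_from 1 (n.+1%:R : R) by exists n; rewrite nat1r.
  rewrite nabla_RL_nat// mulrBl mul1r => <-.
  by rewrite opprD addrA subrr sub0r addNr.
- move=> _ [n ->]; rewrite nat1r nabla_RL_nat//.
  by have /eqP := wE n; rewrite mulrBl mul1r addrAC subr_eq0 => /eqP.
(* At 0 the sum is the single term [s = 0], with diagonal coefficient 1. *)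
- have := nabla_sum_nat (1 - nu) w 0; rewrite !mulr0n => ->.
  rewrite big_ord1 /= mulr0n.
  have -> : 1 - nu - 1 = - nu by rewrite addrAC subrr add0r.
  by have := H_diag nu 0 nu0 nu1; rewrite mulr0n => ->; rewrite mul1r.
Qed.

(** * Existence and uniqueness of the solution *)

(** Iterating on the whole history: each step appends the value that [f] computes from the list so
    far. *)
Lemma exists_course_of_values {T : Type} (f : seq T -> T) :
  exists v : nat -> T, forall n, v n = f (mkseq v n).
Proof.
pose L n := iter n (fun s => rcons s (f s)) [::].
exists (f \o L) => n /=; congr f.
by elim: n => //= n {1}->; rewrite mkseqS.
Qed.

Lemma ml_ivp_exists {R : realType} (nu lambda : R) :
  0 < nu -> nu < 1 -> lambda != 1 -> exists e : R -> R, ml_ivp nu lambda e.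
Proof.
move=> nu0 nu1 l1.
(* The length of the history is the current index: an empty history gives the initial value 1, any
   other the recursion solved for its newest term. *)
have [v vE] := exists_course_of_values (fun s : seq R =>
  if size s is n.+1 then
    - (\sum_(k < n.+1) H (- nu - 1) n.+1%:R (rho k%:R) * s`_k) / (1 - lambda)
  else 1).
exists (fun t => v (Num.truncn t)); apply/ml_ivpP => //; split.
  by rewrite truncn0 vE.
move=> n; rewrite natrK [v n.+1]vE size_mkseq mulrC divfK ?subr_eq0 1?eq_sym//.
apply/eqP; rewrite addrC subr_eq0; apply/eqP.
by apply: eq_bigr => k _; rewrite natrK nth_mkseq.
Qed.

Lemma ml_ivp_unique {R : realType} (nu lambda : R) (w e : R -> R) :
  0 < nu -> nu < 1 -> lambda != 1 -> ml_ivp nu lambda w -> ml_ivp nu lambda e ->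
  forall n : nat, w n%:R = e n%:R.
Proof.
move=> nu0 nu1 l1 /ml_ivpP-/(_ nu0 nu1)[w0 wE] /ml_ivpP-/(_ nu0 nu1)[e0 eE].
elim/ltn_ind => -[_|n ih]; first by rewrite w0 e0.
apply: (@mulfI _ (1 - lambda)); first by rewrite subr_eq0 eq_sym.
(* By [ih] both solutions have the same history sum, so adding it to each side yields the two
   recursions. *)
apply: (addIr (\sum_(k < n.+1) H (- nu - 1) n.+1%:R (rho k%:R) * w k%:R)).
rewrite wE -[LHS](eE n); congr (_ + _); apply: eq_bigr => k _.
by rewrite ih.
Qed.

(** * The triangular linear system *)

(** The determinant is the product of the diagonal, [(1 - lambda) ^+ m]. *)
Lemma Lmx_unit {R : realType} (nu lambda : R) (m : nat) :
  lambda != 1 -> Lmx nu lambda m \in unitmx.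
Proof.
move=> l1; rewrite unitmxE det_trig.
  under eq_bigr do rewrite mxE eqxx.
  by rewrite prodr_const unitrX// unitfE subr_eq0 eq_sym.
by apply/is_trig_mxP => i j ij; rewrite mxE -val_eqE (ltn_eqF ij) ij.
Qed.

(** Row [i] is the recursion at [i.+1]: its [k = 0] term, where [e 0 = 1], is the entry of [Bcol]
    and moves to the right. *)
Lemma Lmx_mul_ml_ivp {R : realType} (nu lambda : R) (m : nat) (e : R -> R) :
  0 < nu -> nu < 1 -> ml_ivp nu lambda e ->
  Lmx nu lambda m *m (\col_(i < m) e i.+1%:R) = - Bcol nu m.
Proof.
move=> nu0 nu1 /ml_ivpP-/(_ nu0 nu1)[e0 eE].
apply/colP => i; rewrite !mxE (bigD1 i)//= !mxE eqxx.
have /eqP := eE i; rewrite big_ord_recl/= mulr0n e0 mulr1 addrCA.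
rewrite addrC addr_eq0 => /eqP <-; apply: f_equal.
under [RHS]eq_bigr => k _ do rewrite /bump leq0n add1n.
(* The history sum is extended to all [m] columns by a mask [j < i], matching the zeros of [Lmx]
   above the diagonal. *)
rewrite (big_ord_widen m (fun k => H (- nu - 1) i.+1%:R (rho k.+1%:R)
  * e k.+1%:R)); last exact: ltnW.
rewrite big_mkcond [RHS]big_mkcond; apply: eq_bigr => j _.
rewrite !mxE -val_eqE [i == j]eq_sym -val_eqE.
by case: ltngtP => // _; rewrite mul0r.
Qed.

Theorem mainTheorem1 (R : realType) (nu lambda : R) (m : nat)
    (nu_gt0 : 0 < nu) (nu_lt1 : nu < 1) (lambda_lt1 : `|lambda| < 1)
    (m_gt0 : (0 < m)%N) :
  (exists e : R -> R, ml_ivp nu lambda e /\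
     forall w : R -> R, ml_ivp nu lambda w ->
       forall t : R, nats_from 0 t -> w t = e t) /\
  Lmx nu lambda m \in unitmx /\
  (forall e : R -> R, ml_ivp nu lambda e ->
     \col_(i < m) e i.+1%:R = - invmx (Lmx nu lambda m) *m Bcol nu m).
Proof.
(* This makes [1 - lambda] invertible, both in the recursion and on the diagonal of [Lmx]. *)
have lambda1 : lambda != 1.
  by apply: contraTneq lambda_lt1 => ->; rewrite normr1 ltxx.
have Lunit := Lmx_unit nu _ m lambda1.
split; last split=> //.
  have [e eP] := ml_ivp_exists _ _ nu_gt0 nu_lt1 lambda1.
  exists e; split=> // w wP _ [n ->]; rewrite add0r.
  exact: (ml_ivp_unique _ _ _ _ nu_gt0 nu_lt1 lambda1).
move=> e /(Lmx_mul_ml_ivp _ _ m _ nu_gt0 nu_lt1) Le.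
by rewrite mulNmx -mulmxN -Le mulKmx.
Qed.
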